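(* Let $N\ge 1$ be an integer. The Kershaw closure $\mathrm{K}_N$ of order $N$ is given by $$ \phi_{N+1}(\phi)=\zeta\, f_{\text{low}}(\phi)+(1-\zeta)\, f_{\text{up}}(\phi) $$ for normalized moment vectors $\phi=(\phi_1,\ldots,\phi_N)$, where the interpolation constant is $$ \zeta=\frac{\frac12\int_{-1}^1\mu^{N+1}\,d\mu-f_{\text{up}}(\phi_{\text{iso}})}{f_{\text{low}}(\phi_{\text{iso}})-f_{\text{up}}(\phi_{\text{iso}})}=\begin{cases} \dfrac{k+2}{2k+3} & \text{ if } N=2k+1,\\[1.5ex] \dfrac12 & \text{ if } N=2k. \end{cases} $$
   Context: Realizability: a vector $(u_0,\ldots,u_M)\in\mathbb{R}^{M+1}$ is realizable if there is a finite non-negative Borel measure $\psi$ on $[-1,1]$ (Dirac deltas are allowed) with positive total mass and $u_i=\int_{-1}^1\mu^i\,d\psi(\mu)$, $i=0,\ldots,M$. A normalized moment vector of order $N$ is $\phi=(\phi_1,\ldots,\phi_N)$ such that $(1,\phi_1,\ldots,\phi_N)$ is realizable; put $\phi_0=1$. Isotropic point: $\phi_{\text{iso}}=(\phi_1,\ldots,\phi_N)$ with $\phi_i=\frac12\int_{-1}^1\mu^i\,d\mu$. Hankel matrices: with $u_i=\phi_i$ and $u_0=1$, set $A(k)=(u_{i+j})_{i,j=0}^{k}$, $B(k)=(u_{i+j+1})_{i,j=0}^{k}$, $C(k)=(u_{i+j})_{i,j=1}^{k}$. $M^\dagger$ is the Moore–Penrose pseudo-inverse of $M$. Bounds on the next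 moment: $f_{\text{up}}(\phi)$ and $f_{\text{low}}(\phi)$ are the upper and lower bounds for $\phi_{N+1}$ imposed by realizability of $(1,\phi_1,\ldots,\phi_{N+1})$, given explicitly as follows. If $N=2k+1$: $$f_{\text{up}}(\phi)=u_{N-1}-\beta_-^T(A(k-1)-C(k))^\dagger\beta_-,\qquad f_{\text{low}}(\phi)=\beta_+^TA(k)^\dagger\beta_+,$$ with $\beta_-=(u_k-u_{k+2},\ldots,u_{N-2}-u_N)^T\in\mathbb{R}^k$ and $\beta_+=(u_{k+1},\ldots,u_N)^T\in\mathbb{R}^{k+1}$ (for $N=1$ the term involving $\beta_-$ is $0$ by convention). If $N=2k$: $$f_{\text{up}}(\phi)=u_N-\beta_-^T(A(k-1)-B(k-1))^\dagger\beta_-,\qquad f_{\text{low}}(\phi)=-u_N+\beta_+^T(A(k-1)+B(k-1))^\dagger\beta_+,$$ with $\beta_\mp=(u_k\mp u_{k+1},\ldots,u_{N-1}\mp u_N)^T\in\mathbb{R}^k$. Kershaw closure: the Kershaw closure $\mathrm{K}_N$ prescribes the unknown normalized moment $\phi_{N+1}$ as a function of $\phi$ by a convex combination $\phi_{N+1}(\phi)=\zeta f_{\text{low}}(\phi)+(1-\zeta)f_{\text{up}}(\phi)$ with a constant $\zeta\in[0,1]$ (independent of $\phi$) chosen so that the isotropic point is interpolated, i.e. $\phi_{N+1}(\phi_{\text{iso}})=\frac12\int_{-1}^1\mu^{N+1}\,d\mu$. *)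

(* Defs.v *)
From HB Require Import structures.
From mathcomp Require Import all_boot all_order all_algebra.
From mathcomp Require Import all_classical all_reals all_analysis.

Set Implicit Arguments.
Unset Strict Implicit.
Unset Printing Implicit Defensive.

Import Order.TTheory GRing.Theory Num.Theory.
Import numFieldNormedType.Exports.

Local Open Scope classical_set_scope.
Local Open Scope ring_scope.

Section MoorePenrose.
Variables (R : realType) (m n : nat).
Implicit Types (A : 'M[R]_(m, n)) (X Y : 'M[R]_(n, m)).

Definition is_moore_penrose A X : Prop :=
  [/\ A *m X *m A = A, X *m A *m X = X,
      (A *m X)^T = A *m X & (X *m A)^T = X *m A].

(* The default value 0 is never used, see pinvP. *)
Definition pinv A : 'M[R]_(n, m) := xget 0 [set X | is_moore_penrose A X].

Lemma is_moore_penrose_uniq A X Y :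
  is_moore_penrose A X -> is_moore_penrose A Y -> X = Y.
Proof.
move=> [AXA XAX sAX sXA] [AYA YAY sAY sYA].
have E1 : A *m X = A *m Y.
  have e : A *m X = A *m Y *m (A *m X) by rewrite !mulmxA AYA.
  by rewrite -sAX e trmx_mul sAX sAY !mulmxA AXA.
have E2 : X *m A = Y *m A.
  have e : X *m A = X *m A *m (Y *m A) by rewrite -!mulmxA (mulmxA A Y) AYA.
  by rewrite -sXA e trmx_mul sXA sYA -!mulmxA (mulmxA A X) AXA.
by rewrite -XAX E2 -mulmxA E1 mulmxA YAY.
Qed.

End MoorePenrose.

Lemma gram_unitmx (R : realType) (m n : nat) (A : 'M[R]_(m, n)) :
  row_free A -> A *m A^T \in unitmx.
Proof.
move=> fA; rewrite -row_free_unit -kermx_eq0; apply/eqP/row_matrixP => i.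
rewrite row0; set v := row i _.
have vAA : v *m (A *m A^T) = 0 by rewrite -row_mul mulmx_ker row0.
have vA0 : v *m A = 0.
  have : (v *m A *m (v *m A)^T) 0 0 = 0.
    by rewrite trmx_mul !mulmxA -(mulmxA v) vAA mul0mx mxE.
  rewrite mxE => /eqP; rewrite psumr_eq0 => [/allP h|j _]; last first.
    by rewrite [X in _ * X]mxE -expr2 sqr_ge0.
  apply/rowP => j; have := h j (mem_index_enum j).
  by rewrite [X in _ * X]mxE -expr2 sqrf_eq0 /= [RHS]mxE => /eqP.
by apply: (row_free_inj fA); rewrite vA0 mul0mx.
Qed.

Lemma pinvP (R : realType) (m n : nat) (A : 'M[R]_(m, n)) :
  is_moore_penrose A (pinv A).
Proof.
apply: (@xgetPex _ _ [set X | is_moore_penrose A X]).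
have [r [B [C [AE fB fC]]]] : exists r (B : 'M[R]_(m, r)) (C : 'M[R]_(r, n)),
    [/\ A = B *m C, row_full B & row_free C].
  exists (\rank A), (col_base A), (row_base A).
  by rewrite mulmx_base col_base_full row_base_free.
have uC : C *m C^T \in unitmx by exact: gram_unitmx.
have uB : B^T *m B \in unitmx.
  by rewrite -{2}[B]trmxK; apply: gram_unitmx; rewrite /row_free mxrank_tr.
pose P := C^T *m invmx (C *m C^T); pose Q := invmx (B^T *m B) *m B^T.
have CP : C *m P = 1%:M by rewrite mulmxA mulmxV.
have QB : Q *m B = 1%:M by rewrite -mulmxA mulVmx.
have AX : A *m (P *m Q) = B *m Q.
  by rewrite AE -mulmxA (mulmxA C) CP mul1mx.
have XA : (P *m Q) *m A = P *m C.
  by rewrite AE -mulmxA (mulmxA Q) QB mul1mx.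
exists (P *m Q); split.
- by rewrite AX AE -mulmxA (mulmxA Q) QB mul1mx.
- by rewrite XA -mulmxA (mulmxA C) CP mul1mx.
- by rewrite AX /Q !trmx_mul trmx_inv trmx_mul trmxK mulmxA.
- by rewrite XA /P !trmx_mul trmx_inv trmx_mul trmxK mulmxA.
Qed.

Section Kershaw.
Variable R : realType.

Definition realizable (M : nat) (u : 'rV[R]_M.+1) : Prop :=
  exists psi : {finite_measure set (measurableTypeR R) -> \bar R},
    [/\ psi (~` `[-1, 1]) = 0%E, (0 < psi setT)%E &
        forall i : 'I_M.+1,
          (u ord0 i)%:E = (\int[psi]_(x in `[(-1)%R, 1%R]) ((x : R) ^+ i)%R%:E)%E].

Definition full_moments (N : nat) (phi : 'rV[R]_N) : 'rV[R]_N.+1 :=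
  row_mx (1%:M : 'M[R]_1) phi.

Definition normalized_moments (N : nat) (phi : 'rV[R]_N) : Prop :=
  realizable (full_moments phi).

Definition iso_moment (i : nat) : R :=
  2^-1 * \int[lebesgue_measure]_(x in `[-1, 1]) (x ^+ i).

(* Column j : 'I_N of phi carries the moment phi_(j+1). *)
Definition phi_iso (N : nat) : 'rV[R]_N := \row_(j < N) iso_moment j.+1.

(* u_i for i <= N; only these indices occur below. *)
Definition moment (N : nat) (phi : 'rV[R]_N) (i : nat) : R :=
  full_moments phi ord0 (inord i).

(* The argument n is the size of the matrix, so that, in the usual notation
   indexed by the largest index, A(k) = hankelA u k.+1, B(k) = hankelB u k.+1,
   A(k-1) = hankelA u k, B(k-1) = hankelB u k, and C(k) = hankelC u k. *)
Definition hankelA (u : nat -> R) n : 'M[R]_n := \matrix_(i, j) u (i + j)%N.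
Definition hankelB (u : nat -> R) n : 'M[R]_n := \matrix_(i, j) u (i + j).+1.
Definition hankelC (u : nat -> R) n : 'M[R]_n :=
  \matrix_(i, j) u (i.+1 + j.+1)%N.

Definition pinv_form n (b : 'cV[R]_n) (M : 'M[R]_n) : R :=
  (b^T *m pinv M *m b) ord0 ord0.

(* N = 2k+1; for k = 0 the quadratic form is an empty sum, hence 0. *)
Definition f_up_odd (k : nat) (u : nat -> R) : R :=
  u (2 * k)%N
  - pinv_form (\col_(i < k) (u (k + i)%N - u (k + i).+2))
              (hankelA u k - hankelC u k).

Definition f_low_odd (k : nat) (u : nat -> R) : R :=
  pinv_form (\col_(i < k.+1) u (k + i).+1) (hankelA u k.+1).

(* N = 2k *)
Definition f_up_even (k : nat) (u : nat -> R) : R :=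
  u (2 * k)%N
  - pinv_form (\col_(i < k) (u (k + i)%N - u (k + i).+1))
              (hankelA u k - hankelB u k).

Definition f_low_even (k : nat) (u : nat -> R) : R :=
  - u (2 * k)%N
  + pinv_form (\col_(i < k) (u (k + i)%N + u (k + i).+1))
              (hankelA u k + hankelB u k).

Definition f_up (N : nat) (phi : 'rV[R]_N) : R :=
  if odd N then f_up_odd N./2 (moment phi) else f_up_even N./2 (moment phi).

Definition f_low (N : nat) (phi : 'rV[R]_N) : R :=
  if odd N then f_low_odd N./2 (moment phi) else f_low_even N./2 (moment phi).

(* F : phi |-> phi_(N+1); its values outside the realizable set are irrelevant. *)
Definition kershaw_closure (N : nat) (zeta : R) (F : 'rV[R]_N -> R) : Prop :=
  [/\ 0 <= zeta <= 1,
      forall phi : 'rV[R]_N, normalized_moments phi ->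
        F phi = zeta * f_low phi + (1 - zeta) * f_up phi &
      F (phi_iso N) = iso_moment N.+1].

End Kershaw.

Arguments iso_moment R i : clear implicits.
Arguments phi_iso R N : clear implicits.

(* Main.v *)
(* For a weight [w] and the mean over [-1,1], the quadratic form built from the
   Gram matrix of the monomials of degree less than [n] is the squared norm of
   the projection of [X^n], hence it equals the mean of [w X^(2n)] minus that of
   [w q^2], where [q] is the monic orthogonal polynomial of degree [n].  At the
   isotropic point both bounds are thus the next moment shifted by such a norm:
   for N = 2k+1 the weights are 1 (degree k+1) and 1 - X^2 (degree k), for N = 2k
   they are 1 + X and 1 - X (degree k).  In the even case the reflection X -> -X
   exchanges the weights and the norms agree.  In the odd case, if [q] is
   orthogonal for the weight 1 then [q'] is orthogonal for 1 - X^2, and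
   integrating by parts gives the ratio (k+2)/(k+1) of the norms. *)
From HB Require Import structures.
From mathcomp Require Import zify ring lra polyrcf.
Require Import Defs.
From mathcomp Require Import all_boot all_order all_algebra.
From mathcomp Require Import all_classical all_reals all_analysis.
From mathcomp Require Import measurable_realfun.
Import Order.TTheory GRing.Theory Num.Theory.
Import numFieldNormedType.Exports.
Set Implicit Arguments.
Unset Strict Implicit.
Unset Printing Implicit Defensive.
Local Open Scope ring_scope.

(** * Averaging polynomials over [-1,1] algebraically *)

Section PolynomialMean.
Variable R : rcfType.
Implicit Types (p q r w : {poly R}) (n i : nat).

(* The junk value [1 / 0 = 0] makes the constant coefficient vanish. *)
Definition antideriv p : {poly R} :=
  \poly_(i < (size p).+1) (p`_i.-1 / i%:R).

Lemma coef_antideriv p i : (antideriv p)`_i = p`_i.-1 / i%:R.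
Proof.
rewrite coef_poly; case: ltnP => //; case: i => // i; rewrite ltnS => hi.
by rewrite nth_default ?mul0r.
Qed.

Lemma antideriv_is_linear : linear antideriv.
Proof.
move=> a p q; apply/polyP => i.
by rewrite !(coefD, coefZ, coef_antideriv) mulrDl mulrA.
Qed.

HB.instance Definition _ :=
  GRing.isLinear.Build R {poly R} {poly R} *:%R antideriv antideriv_is_linear.

Lemma antiderivK p : (antideriv p)^`() = p.
Proof.
apply/polyP => i.
by rewrite coef_deriv coef_antideriv /= -[LHS]mulr_natr divfK ?pnatr_eq0.
Qed.

Lemma antideriv_deriv p : antideriv p^`() = p - (p`_0)%:P.
Proof.
apply/polyP => -[|i]; rewrite coef_antideriv coefB coefC /=.
  by rewrite invr0 mulr0 subrr.
by rewrite coef_deriv -[X in X / _]mulr_natr mulfK ?pnatr_eq0 // subr0.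
Qed.

(** Half the integral of [p] over [-1,1]; the algebraic form makes integration by parts and
    reflection polynomial identities. *)
Definition mean p : R := ((antideriv p).[1] - (antideriv p).[-1]) / 2.

Lemma mean_is_scalar : scalar mean.
Proof.
move=> a p q; change (mean (a *: p + q) = a * mean p + mean q).
by rewrite /mean linearP /= !(hornerD, hornerZ); ring.
Qed.

HB.instance Definition _ :=
  GRing.isLinear.Build R {poly R} R *%R mean mean_is_scalar.

Lemma mean_deriv p : mean p^`() = (p.[1] - p.[-1]) / 2.
Proof. by rewrite /mean antideriv_deriv !hornerD !hornerN !hornerC; ring. Qed.

Lemma mean_reflect p : mean (p \Po - 'X) = mean p.
Proof.
have {1}-> : p \Po - 'X = (- (antideriv p \Po - 'X))^`().
  by rewrite derivN deriv_comp antiderivK derivN derivX mulrN1 opprK.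
rewrite mean_deriv !hornerN !horner_comp !hornerN !hornerX !opprK.
by rewrite /mean addrC.
Qed.

Lemma mean_by_parts p q :
  (p * q).[1] = (p * q).[-1] -> mean (p^`() * q) = - mean (p * q^`()).
Proof.
move=> pq; apply/eqP; rewrite -addr_eq0 -linearD /= -derivM mean_deriv pq.
by rewrite subrr mul0r.
Qed.

(** The antiderivative is nondecreasing on [-1,1]. If it did not grow from -1 to 1 it would be
    constant there, hence constant as a polynomial, and its derivative [p] would vanish. *)
Lemma mean_gt0 p :
  p != 0 -> (forall x, x \in `]-1, 1[ -> 0 <= p.[x]) -> 0 < mean p.
Proof.
move=> p0 pge0; set P := antideriv p.
have P'ge0 x : x \in `](-1), 1[ -> 0 <= P^`().[x] by rewrite antiderivK; exact: pge0.
have mono := ler_hornerW P'ge0.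
rewrite divr_gt0 // subr_gt0 ltNge; apply/negP => leP.
have Pcst x : x \in `[-1, 1] -> P.[x] = P.[1].
  move=> xI; apply/eqP; rewrite eq_le; have := xI; rewrite in_itv /= => /andP[x1 x2].
  rewrite mono //=; last by rewrite in_itv /=; apply/andP; split; lra.
  apply: le_trans leP _; apply: mono => //.
  by rewrite in_itv /=; apply/andP; split; lra.
case/eqP: p0; rewrite -(antiderivK p) -/P.
suff -> : P = (P.[1])%:P by rewrite derivC.
apply/eqP; rewrite -subr_eq0; set Q := _ - _.
(* The points 1/(i+1) are distinct, lie in [-1,1], and are too many to be roots of a nonzero [Q]. *)
pose rs : seq R := [seq i.+1%:R^-1 | i <- iota 0 (size Q)].
apply/eqP/(@roots_geq_poly_eq0 _ Q rs); last by rewrite size_map size_iota.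
  apply/allP => _ /mapP[i _ ->]; rewrite /root /Q !hornerE subr_eq0; apply/eqP/Pcst.
  rewrite in_itv /= invf_le1 ?ltr0n // ler1n andbT.
  by rewrite (le_trans (lerN10 _)) // invr_ge0 ler0n.
rewrite map_inj_uniq ?iota_uniq // => i j /invr_inj/eqP.
by rewrite eqr_nat eqSS => /eqP.
Qed.

End PolynomialMean.

(** * Gram matrices, orthogonal polynomials and projections *)

Section OrthogonalPolynomials.
Variable R : realType.
Implicit Types (p q r w : {poly R}) (n i : nat).

Definition positive_weight w :=
  w != 0 /\ forall x, x \in `]-1, 1[ -> 0 <= w.[x].

Lemma mean_weight_sqr_gt0 w p :
  positive_weight w -> p != 0 -> 0 < mean (w * p * p).
Proof.
move=> [w0 wge0] p0; rewrite -mulrA; apply: mean_gt0 => [|x xI].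
  by rewrite !mulf_neq0.
by rewrite !hornerM mulr_ge0 ?wge0 // -expr2 sqr_ge0.
Qed.

Definition orthogonal_poly w n q :=
  [/\ q \is monic, size q = n.+1 &
      forall r, (size r <= n)%N -> mean (w * q * r) = 0].

Definition gram w n : 'M[R]_n := \matrix_(i, j) mean (w * 'X^(i + j)).

Lemma gram_sym w n : (gram w n)^T = gram w n.
Proof. by apply/matrixP => i j; rewrite !mxE addnC. Qed.

Lemma mean_mul_poly w p n :
  (size p <= n)%N -> mean (w * p) = \sum_(j < n) mean (w * 'X^j) * p`_j.
Proof.
move=> sp; have {1}-> : p = \sum_(j < n) p`_j *: 'X^j.
  rewrite -poly_def; apply/polyP => i; rewrite coef_poly.
  by case: ltnP => // /(leq_trans sp) /(nth_default 0).
rewrite mulr_sumr linear_sum /=; apply: eq_bigr => j _.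
by rewrite -scalerAr linearZ /= mulrC.
Qed.

Lemma gram_mulmx w p n : (size p <= n)%N ->
  gram w n *m (\col_j p`_j) = \col_i mean (w * 'X^i * p).
Proof.
move=> sp; apply/colP => i; rewrite !mxE (mean_mul_poly _ (n := n)) //.
by apply: eq_bigr => j _; rewrite !mxE exprD mulrA.
Qed.

(** A kernel vector is the coefficient vector of a polynomial orthogonal to all monomials of degree
    less than [n], hence to itself, so it is zero by positivity. *)
Lemma gram_unit w n : positive_weight w -> gram w n \in unitmx.
Proof.
move=> pw; rewrite -row_free_unit -kermx_eq0; apply/eqP/row_matrixP => i.
rewrite row0; set v := row i _.
have vG : v *m gram w n = 0 by rewrite -row_mul mulmx_ker row0.
pose p := rVpoly v; have sp : (size p <= n)%N by exact: size_poly.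
have vE : v^T = \col_j p`_j.
  by apply/colP => j; rewrite [LHS]mxE [RHS]mxE coef_rVpoly_ord.
have Gp : \col_i mean (w * 'X^i * p) = 0 :> 'cV_n.
  by rewrite -gram_mulmx // -vE -gram_sym -trmx_mul vG trmx0.
suff p0 : p = 0 by rewrite -(rVpolyK v) -/p p0 linear0.
apply/eqP/negP => /negP /(mean_weight_sqr_gt0 pw).
rewrite (mean_mul_poly _ sp) big1 ?ltxx // => j _.
have := congr1 (fun c : 'cV_n => c j 0) Gp; rewrite !mxE mulrAC => ->.
by rewrite mul0r.
Qed.

(** Subtract from ['X^n] its projection onto lower degrees, whose coefficients solve the normal
    equations. *)
Lemma exists_orthogonal_poly w n :
  positive_weight w -> exists q, orthogonal_poly w n q.
Proof.
move=> pw; pose b : 'cV[R]_n := \col_i mean (w * 'X^i * 'X^n).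
pose p := rVpoly (invmx (gram w n) *m b)^T.
have sp : (size p <= n)%N by exact: size_poly.
have Gp : gram w n *m (\col_j p`_j) = b.
  rewrite (_ : (\col_j p`_j) = invmx (gram w n) *m b); last first.
    by apply/colP => j; rewrite mxE coef_rVpoly_ord mxE.
  by rewrite mulmxA mulmxV ?gram_unit // mul1mx.
exists ('X^n - p); have sq : size ('X^n - p) = n.+1.
  by rewrite size_polyDl size_polyXn // size_polyN ltnS.
split=> //.
  rewrite monicE /lead_coef sq /= coefB coefXn eqxx.
  by rewrite nth_default // subr0.
move=> r sr; rewrite (mean_mul_poly _ (n := n)) // big1 // => j _.
have /colP/(_ j) := Gp; rewrite gram_mulmx // !mxE => e.
by rewrite [w * _ * _]mulrAC mulrBr linearB /= e subrr mul0r.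
Qed.

(** For a vector in the range of [M], symmetry puts a factor [M] on each side of the pseudo-inverse,
    and the first Penrose identity removes it. *)
Lemma pinv_form_mulmx n (M : 'M[R]_n) (c : 'cV[R]_n) :
  M^T = M -> pinv_form (M *m c) M = (c^T *m M *m c) 0 0.
Proof.
move=> sM; have [MPM _ _ _] := pinvP M.
rewrite /pinv_form trmx_mul sM !mulmxA -(mulmxA c^T M (Defs.pinv M)).
by rewrite -(mulmxA c^T _ M) MPM.
Qed.

(* Both sides are the squared norm of the projection of ['X^n] onto the
   polynomials of degree less than [n], which is ['X^n - q]. *)
Lemma pinv_form_gram w n q : orthogonal_poly w n q ->
  pinv_form (\col_(i < n) mean (w * 'X^(n + i))) (gram w n)
  = mean (w * 'X^(2 * n)) - mean (w * q * q).
Proof.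
move=> [mq sq oq]; pose p := 'X^n - q.
have sp : (size p <= n)%N.
  apply/leq_sizeP => i; rewrite leq_eqVlt => /predU1P[<-|ni].
    move: mq; rewrite monicE /lead_coef sq coefB coefXn eqxx /= => /eqP->.
    by rewrite subrr.
  by rewrite coefB coefXn gtn_eqF // nth_default ?subrr // sq.
have bE : \col_(i < n) mean (w * 'X^(n + i)) = gram w n *m (\col_j p`_j).
  rewrite gram_mulmx //; apply/colP => i; rewrite !mxE mulrBr linearB /=.
  rewrite [w * _ * q]mulrAC oq ?size_polyXn ?ltn_ord // subr0.
  by rewrite -mulrA -exprD addnC.
rewrite bE pinv_form_mulmx ?gram_sym // -mulmxA -bE mxE.
rewrite (_ : \sum_j _ = mean (w * 'X^n * p)); last first.
  rewrite (mean_mul_poly _ sp); apply: eq_bigr => j _.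
  by rewrite !mxE exprD mulrA mulrC.
rewrite {1}/p mulrBr linearB /= -[w * _ * 'X^n]mulrA -exprD mul2n addnn.
congr (_ - _).
(* As [q] is orthogonal to ['X^n - q], its product with ['X^n] has the same weighted mean as its
   square. *)
have := oq _ sp; rewrite /p mulrBr linearB /= => /eqP.
by rewrite subr_eq0 => /eqP <-; rewrite [w * _ * q]mulrAC.
Qed.
End OrthogonalPolynomials.

(** * The two bounds in terms of norms of orthogonal polynomials *)

Section KershawBounds.
Variable R : realType.
Implicit Types (p q r w : {poly R}) (k n i : nat) (u : nat -> R).

Lemma positive_weight1 : positive_weight (1 : {poly R}).
Proof. by split=> [|x _]; rewrite ?oner_neq0 // hornerC. Qed.

Lemma positive_weight_1subX : positive_weight (1 - 'X : {poly R}).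
Proof.
split=> [|x]; first by rewrite -opprB oppr_eq0 polyXsubC_eq0.
by rewrite in_itv /= !hornerE => /andP[_ /ltW]; rewrite subr_ge0.
Qed.

Lemma positive_weight_1subX2 : positive_weight (1 - 'X^2 : {poly R}).
Proof.
split=> [|x].
  by rewrite -opprB oppr_eq0 -size_poly_eq0 size_XnsubC.
by rewrite in_itv /= !hornerE => /andP[? ?]; nra.
Qed.

Lemma comp_polyNX_inv p : p \Po - 'X \Po - 'X = p.
Proof. by rewrite -comp_polyA linearN /= comp_polyX opprK comp_polyXr. Qed.

Lemma size_comp_polyNX p : size (p \Po - 'X) = size p.
Proof. by rewrite size_comp_poly2 // size_polyN size_polyX. Qed.

(** The substitution X -> -X swaps the two weights and preserves the mean; the sign restores a
    leading coefficient 1. *)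
Lemma orthogonal_poly_reflect n q : orthogonal_poly (1 - 'X) n q ->
  orthogonal_poly (1 + 'X) n ((-1) ^+ n *: (q \Po - 'X)).
Proof.
move=> [mq sq oq]; split.
- rewrite monicE lead_coefZ lead_coef_comp ?size_polyN ?size_polyX //.
  by rewrite (monicP mq) mul1r lead_coefN lead_coefX sq /= -expr2 sqrr_sign.
- by rewrite size_scale ?signr_eq0 // size_comp_polyNX.
move=> r sr; rewrite -mean_reflect !comp_polyM comp_polyD comp_polyC comp_polyX.
rewrite comp_polyZ comp_polyNX_inv -scalerAr -scalerAl linearZ /= oq ?mulr0 //.
by rewrite size_comp_polyNX.
Qed.

Lemma mean_sqr_reflect n q (q' := (-1) ^+ n *: (q \Po - 'X)) :
  mean ((1 + 'X) * q' * q') = mean ((1 - 'X) * q * q).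
Proof.
rewrite -mean_reflect /q' !comp_polyM comp_polyD comp_polyC comp_polyX.
rewrite comp_polyZ comp_polyNX_inv -!scalerAr -!scalerAl scalerA -expr2 sqrr_sign.
by rewrite scale1r.
Qed.

(** The weight vanishes at both endpoints, so there is no boundary term. *)
Lemma mean_legendre_by_parts q r :
  mean ((1 - 'X^2) * q^`() * r) = - mean (1 * q * ((1 - 'X^2) * r)^`()).
Proof.
have w0 x : x ^+ 2 = 1 -> (1 - 'X^2 : {poly R}).[x] = 0.
  by rewrite hornerD hornerN hornerC hornerXn => ->; rewrite subrr.
rewrite mul1r -mean_by_parts; first by rewrite mulrA [q^`() * _]mulrC.
by rewrite !hornerM !w0 ?sqrrN ?expr1n // !(mul0r, mulr0).
Qed.

Lemma size_deriv_le p n : (size p <= n.+1)%N -> (size p^`() <= n)%N.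
Proof.
have [->|p0] := eqVneq p 0; first by rewrite deriv0 size_poly0.
by move=> sp; rewrite -ltnS (leq_trans _ sp) // lt_size_deriv.
Qed.

(** By parts, testing against [r] of degree less than [k] becomes testing [q] against the derivative
    of (1 - X^2) r, of degree at most [k], where orthogonality of [q] applies. *)
Lemma orthogonal_poly_deriv k q : orthogonal_poly 1 k.+1 q ->
  orthogonal_poly (1 - 'X^2) k (k.+1%:R^-1 *: q^`()).
Proof.
move=> [mq sq oq].
have q'k : q^`()`_k = k.+1%:R.
  by move: mq; rewrite monicE /lead_coef sq coef_deriv /= => /eqP ->.
have k0 : k.+1%:R != 0 :> R by rewrite pnatr_eq0.
have sq' : size q^`() = k.+1.
  apply/eqP; rewrite eqn_leq size_deriv_le ?sq //= ltnNge.
  by apply: contra_neqN k0 => /leq_sizeP/(_ k (leqnn k)); rewrite q'k.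
split.
- by rewrite monicE lead_coefZ /lead_coef sq' q'k mulVf.
- by rewrite size_scale // invr_eq0.
move=> r sr; rewrite -scalerAr -scalerAl linearZ /= mean_legendre_by_parts oq.
  by rewrite oppr0 mulr0.
apply: size_deriv_le; rewrite (leq_trans (size_polyMleq _ _)) //.
by rewrite -opprB size_polyN size_XnsubC.
Qed.

(* By orthogonality only the leading coefficient of [((1 - X^2) q')'],
   which is [- (k+1) (k+2)], contributes. *)
Lemma mean_sqr_deriv k q : orthogonal_poly 1 k.+1 q ->
  mean ((1 - 'X^2) * q^`() * q^`()) = (k.+1 * k.+2)%:R * mean (1 * q * q).
Proof.
move=> [mq sq oq]; rewrite mean_legendre_by_parts.
set s := (X in 1 * q * X); set c := _%:R.
(* Adding [c *: q] cancels the coefficient of degree k+1 in [s], leaving a polynomial orthogonal to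
   [q]. *)
have /oq : (size (s + c *: q)%R <= k.+1)%N.
  apply/leq_sizeP => -[//|i] ki; rewrite coefD coefZ /s coef_deriv mulrBl mul1r.
  have q3 : q`_i.+3 = 0 by rewrite nth_default ?sq ?ltnS // ltnW.
  rewrite coefB coefXnM !coef_deriv q3 mul0rn sub0r /= subSS subSS subn0.
  rewrite -mulNrn -mulrnA -[_ *+ (_ * _)]mulr_natl mulrN addrC -mulrBl.
  move: ki; rewrite ltnS leq_eqVlt => /predU1P[<-|ki]; first by rewrite subrr mul0r.
  by rewrite [q`__]nth_default ?sq ?mulr0 ?ltnS.
rewrite mulrDr linearD /= -scalerAr linearZ /= => /eqP.
by rewrite addrC addr_eq0 => /eqP ->.
Qed.

(** The differences [u i - u i.+2] are moments for the weight 1 - X^2. Subtracting the projection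
    from [u (2 * k)] leaves the moment of order 2k+2 and flips the sign of the norm. *)
Lemma f_up_oddE k u q : (forall i, (i <= 2 * k + 1)%N -> u i = mean 'X^i) ->
  orthogonal_poly (1 - 'X^2) k q ->
  f_up_odd k u = mean 'X^(2 * k + 2) + mean ((1 - 'X^2) * q * q).
Proof.
move=> uE oq; have wE i : (i < 2 * k)%N ->
    u i - u i.+2 = mean ((1 - 'X^2) * 'X^i).
  move=> ik; rewrite !uE ?[(2 * k + 1)%N]addn1 ?ltnS //; last exact: leqW (ltnW ik).
  by rewrite mulrBl mul1r -exprD linearB.
rewrite /f_up_odd (_ : _ - hankelC u k = gram (1 - 'X^2) k); last first.
  apply/matrixP => i j; rewrite !mxE addnS addSn wE //.
  by rewrite mul2n -addnn -addSn leq_add // ltnW.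
rewrite (_ : \col_i _ = \col_(i < k) mean ((1 - 'X^2) * 'X^(k + i))); last first.
  by apply/colP => i; rewrite !mxE wE // mul2n -addnn ltn_add2l.
rewrite (pinv_form_gram oq) uE ?leq_addr // mulrBl mul1r -exprD linearB /=.
by rewrite addnC; ring.
Qed.

Lemma f_low_oddE k u q : (forall i, (i <= 2 * k + 1)%N -> u i = mean 'X^i) ->
  orthogonal_poly 1 k.+1 q ->
  f_low_odd k u = mean 'X^(2 * k + 2) - mean (1 * q * q).
Proof.
move=> uE oq; rewrite /f_low_odd (_ : hankelA u _ = gram 1 k.+1); last first.
  apply/matrixP => i j; rewrite !mxE uE ?mul1r // //.
  by have := ltn_ord i; have := ltn_ord j; lia.
rewrite (_ : \col_i _ = \col_(i < k.+1) mean (1 * 'X^(k.+1 + i))); last first.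
  apply/colP => i; rewrite !mxE uE ?mul1r // mul2n -addnn addn1 ltnS leq_add2l.
  by rewrite -ltnS.
by rewrite (pinv_form_gram oq) mul1r mulnS addnC.
Qed.

Lemma f_up_evenE k u q : (forall i, (i <= 2 * k)%N -> u i = mean 'X^i) ->
  orthogonal_poly (1 - 'X) k q ->
  f_up_even k u = mean 'X^(2 * k + 1) + mean ((1 - 'X) * q * q).
Proof.
move=> uE oq; have wE i : (i < 2 * k)%N ->
    u i - u i.+1 = mean ((1 - 'X) * 'X^i).
  move=> ik; rewrite !uE ?(ltnW ik) //.
  by rewrite mulrBl mul1r -exprS linearB.
rewrite /f_up_even (_ : _ - hankelB u k = gram (1 - 'X) k); last first.
  apply/matrixP => i j; rewrite !mxE wE //.
  by rewrite mul2n -addnn -addSn leq_add // ltnW.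
rewrite (_ : \col_i _ = \col_(i < k) mean ((1 - 'X) * 'X^(k + i))); last first.
  by apply/colP => i; rewrite !mxE wE // mul2n -addnn ltn_add2l.
rewrite (pinv_form_gram oq) uE // mulrBl mul1r -exprS linearB /=.
by rewrite addn1; ring.
Qed.

Lemma f_low_evenE k u q : (forall i, (i <= 2 * k)%N -> u i = mean 'X^i) ->
  orthogonal_poly (1 + 'X) k q ->
  f_low_even k u = mean 'X^(2 * k + 1) - mean ((1 + 'X) * q * q).
Proof.
move=> uE oq; have wE i : (i < 2 * k)%N ->
    u i + u i.+1 = mean ((1 + 'X) * 'X^i).
  move=> ik; rewrite !uE ?(ltnW ik) //.
  by rewrite mulrDl mul1r -exprS linearD.
rewrite /f_low_even (_ : _ + hankelB u k = gram (1 + 'X) k); last first.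
  apply/matrixP => i j; rewrite !mxE wE //.
  by rewrite mul2n -addnn -addSn leq_add // ltnW.
rewrite (_ : \col_i _ = \col_(i < k) mean ((1 + 'X) * 'X^(k + i))); last first.
  by apply/colP => i; rewrite !mxE wE // mul2n -addnn ltn_add2l.
rewrite (pinv_form_gram oq) uE // mulrDl mul1r -exprS linearD /=.
by rewrite addn1; ring.
Qed.

End KershawBounds.

(** * Lebesgue integrals, and the bounds at the isotropic point *)

Section IsotropicPoint.
Variable R : realType.
Local Notation mu := (@lebesgue_measure R).
Local Open Scope classical_set_scope.
Implicit Types (i k N : nat).

Lemma integral_horner (p : {poly R}) :
  (\int[mu]_(x in `[(-1)%R, 1%R]) (p.[x])%:E = (2 * mean p)%:E)%E.
Proof.
rewrite (@continuous_FTC2 _ (horner p) (horner (antideriv p))) //.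
- by rewrite -EFinB /mean mulrC divfK ?pnatr_eq0.
- by apply: continuous_subspaceT => x; exact: continuous_horner.
- split => [x _||]; first exact: derivable_horner.
    by apply: cvg_at_right_filter; exact: continuous_horner.
  by apply: cvg_at_left_filter; exact: continuous_horner.
- by move=> x _; rewrite -derivE antiderivK.
Qed.

Lemma iso_momentE i : iso_moment R i = mean 'X^i.
Proof.
rewrite /iso_moment /Rintegral; under eq_integral do rewrite -hornerXn.
by rewrite integral_horner /= mulrA mulVf ?pnatr_eq0 // mul1r.
Qed.

Lemma iso_moment0 : iso_moment R 0 = 1.
Proof.
rewrite iso_momentE expr0 -(derivX R) mean_deriv !hornerX opprK.
by rewrite divff // -natr1 pnatr_eq0.
Qed.

Lemma full_moments_iso N (i : 'I_N.+1) :
  full_moments (phi_iso R N) ord0 i = iso_moment R i.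
Proof.
rewrite /full_moments mxE; case: splitP => j ij; rewrite mxE.
  by rewrite ij !ord1 eqxx iso_moment0.
by congr iso_moment.
Qed.

Lemma moment_iso N i : (i <= N)%N -> moment (phi_iso R N) i = mean 'X^i.
Proof.
by move=> iN; rewrite /moment full_moments_iso inordK // iso_momentE.
Qed.

(** The representing measure is the uniform probability on [-1,1]. This allows the closure formula
    to be evaluated at the isotropic point. *)
Lemma normalized_moments_iso N : normalized_moments (phi_iso R N).
Proof.
have lt11 : (-1 < 1 :> R)%R by lra.
exists (uniform_prob lt11); split.
- rewrite /= /uniform_prob integral_uniform_pdf setICl.
  by rewrite integral_set0.
- exact: (eq_ind_r (fun t => (0 < t)%E) lte01
    (probability_setT (uniform_prob lt11))).
move=> i; rewrite full_moments_iso.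
pose D : set (measurableTypeR R) := `[(-1)%R, 1%R].
pose f (x : measurableTypeR R) := (('X^i : {poly R}).[x])%:E.
have mD : measurable D by exact: measurable_itv.
have fi : mu.-integrable D f.
  apply: continuous_compact_integrable; first exact: segment_compact.
  by apply: continuous_subspaceT => x; exact: continuous_horner.
have fDi : mu.-integrable setT (f \_ D) by apply/(integrable_mkcond f mD).
have fDiD : mu.-integrable D (f \_ D) by exact: integrableS fDi.
have mfD := measurable_int _ fDi.
rewrite [RHS](_ : _ = \int[uniform_prob lt11]_(x in D) f x)%E; last first.
  by apply: eq_integral => x _; rewrite /f hornerXn.
(* [integral_uniform] handles nonnegative functions, while odd powers change sign: the positive and
   negative parts are treated separately and then recombined. *)
rewrite integral_mkcond integralE !integral_uniform //; first last.
- exact: measurable_funepos.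
- exact: measurable_funeneg.
rewrite -muleBr ?fin_num_adde_defr ?integrable_pos_fin_num //.
rewrite -integralE (eq_integral f) => [|x xD]; last by rewrite patchE xD.
by rewrite integral_horner opprK -EFinM mulrA mulVf ?pnatr_eq0 // mul1r iso_momentE.
Qed.

(** The shifts [a] and [b] are the squared norms of the monic orthogonal polynomials; their ratio
    alone determines the interpolation constant. *)
Lemma f_bounds_iso N : exists a b : R,
  [/\ 0 < a, 0 < b,
      f_up (phi_iso R N) = iso_moment R N.+1 + a,
      f_low (phi_iso R N) = iso_moment R N.+1 - b &
      if odd N then a * (N./2 + 1)%:R = b * (N./2 + 2)%:R else a = b].
Proof.
rewrite /f_up /f_low iso_momentE.
have := odd_double_half N; rewrite -mul2n; case: (odd N) => /= NE.
  have uE i : (i <= 2 * N./2 + 1)%N -> moment (phi_iso R N) i = mean 'X^i.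
    by move=> iN; apply: moment_iso; rewrite -NE addnC.
  have [q oq] := exists_orthogonal_poly N./2.+1 (positive_weight1 R).
  have oq' := orthogonal_poly_deriv oq.
  exists (mean ((1 - 'X^2) * (N./2.+1%:R^-1 *: q^`()) * (N./2.+1%:R^-1 *: q^`()))).
  exists (mean (1 * q * q)).
  rewrite (f_up_oddE uE oq') (f_low_oddE uE oq).
  have -> : N.+1 = (2 * N./2 + 2)%N by lia.
  split=> //.
  - apply: mean_weight_sqr_gt0; first exact: positive_weight_1subX2.
    by case: oq' => _ sq _; rewrite -size_poly_eq0 sq.
  - apply: mean_weight_sqr_gt0; first exact: positive_weight1.
    by case: oq => _ sq _; rewrite -size_poly_eq0 sq.
  (* The normalization 1/(k+1) enters squared; against the factor (k+1)(k+2) from [mean_sqr_deriv]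
     it leaves the ratio (k+2)/(k+1). *)
  set c := _^-1; have -> : (1 - 'X^2) * (c *: q^`()) * (c *: q^`())
      = (c * c) *: ((1 - 'X^2) * q^`() * q^`()).
    by rewrite -!mul_polyC polyCM; ring.
  rewrite linearZ /= (mean_sqr_deriv oq) {}/c.
  have k0 : N./2.+1%:R != 0 :> R by rewrite pnatr_eq0.
  by rewrite natrM addn1 addn2; field.
have uE i : (i <= 2 * N./2)%N -> moment (phi_iso R N) i = mean 'X^i.
  by move=> iN; apply: moment_iso; rewrite -NE.
have [q oq] := exists_orthogonal_poly N./2 (positive_weight_1subX R).
have oq' := orthogonal_poly_reflect oq.
exists (mean ((1 - 'X) * q * q)), (mean ((1 - 'X) * q * q)).
rewrite (f_up_evenE uE oq) (f_low_evenE uE oq') mean_sqr_reflect.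
have -> : N.+1 = (2 * N./2 + 1)%N by lia.
have q0 : 0 < mean ((1 - 'X) * q * q).
  apply: mean_weight_sqr_gt0; first exact: positive_weight_1subX.
  by case: oq => _ sq _; rewrite -size_poly_eq0 sq.
by split.
Qed.

End IsotropicPoint.

(** * Uniqueness and value of the interpolation constant *)

Theorem theorem4p5 (R : realType) (N : nat) (hN : (1 <= N)%N) :
  let zeta : R :=
    (iso_moment R N.+1 - f_up (phi_iso R N))
      / (f_low (phi_iso R N) - f_up (phi_iso R N)) in
  [/\ f_low (phi_iso R N) - f_up (phi_iso R N) != 0,
      (forall (z : R) (F : 'rV[R]_N -> R),
         kershaw_closure z F <->
         z = zeta /\
         (forall phi : 'rV[R]_N, normalized_moments phi ->
            F phi = zeta * f_low phi + (1 - zeta) * f_up phi)),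
      (forall k : nat, N = (2 * k + 1)%N -> zeta = (k + 2)%:R / (2 * k + 3)%:R)
    & (forall k : nat, N = (2 * k)%N -> zeta = 1 / 2)].
Proof.
have [a [b [a0 b0 upE lowE ab]]] := f_bounds_iso R N => zeta.
have ab0 : a + b != 0 by rewrite gt_eqF ?addr_gt0.
have lowup : f_low (phi_iso R N) - f_up (phi_iso R N) = - (a + b).
  by rewrite upE lowE; ring.
have lowup0 : f_low (phi_iso R N) - f_up (phi_iso R N) != 0.
  by rewrite lowup oppr_eq0.
have zetaE : zeta = a / (a + b) by rewrite /zeta lowup upE; field.
have isoE : zeta * f_low (phi_iso R N) + (1 - zeta) * f_up (phi_iso R N)
    = iso_moment R N.+1 by rewrite zetaE upE lowE; field.
split=> // [z F|k NE|k NE].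
- split=> [[_ FE Fiso]|[-> FE]].
    (* At the isotropic point the convex combination is affine in [z] with nonzero slope
       [f_low - f_up], so its value there determines [z]. *)
    have zE : z = zeta.
      have := FE _ (normalized_moments_iso R N); rewrite Fiso -isoE => e.
      apply: (mulIf lowup0); apply: (addIr (f_up (phi_iso R N))).
      transitivity (z * f_low (phi_iso R N) + (1 - z) * f_up (phi_iso R N)).
        by ring.
      by rewrite -e; ring.
    by split=> // phi /FE; rewrite zE.
  split=> //; last by rewrite FE //; exact: normalized_moments_iso.
  (* The constant lies in [0,1] because [a] and [b] are positive. *)
  rewrite zetaE; apply/andP; split; first by rewrite divr_ge0 ?addr_ge0 ?ltW.
  by rewrite ler_pdivrMr ?addr_gt0 // mul1r lerDl ltW.
- have [No Nk] : odd N = true /\ N./2 = k by lia.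
  move: ab; rewrite No Nk => ab.
  have k1 : (k + 1)%:R != 0 :> R by rewrite pnatr_eq0 addn1.
  have k3 : (2 * k + 3)%:R != 0 :> R by rewrite pnatr_eq0 addn3.
  rewrite zetaE; apply/eqP; rewrite eqr_div //; apply/eqP.
  (* Since a : b = (k+2) : (k+1), the denominator a + b corresponds to this sum. *)
  have -> : (2 * k + 3 = (k + 1) + (k + 2))%N by lia.
  by rewrite [LHS]mulrC natrD mulrDl mulrDr [_ * a]mulrC ab; ring.
- have No : odd N = false by lia.
  move: ab; rewrite No => ab; rewrite zetaE ab; field.
  by move: ab0; rewrite ab.
Qed.
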